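(* Let $F:\{0,1\}^{\mathbb{Z}}\to\{0,1\}^{\mathbb{Z}}$ be the global function of elementary cellular automaton rule 172 and let $x\in\{0,1\}^{\mathbb{Z}}$. Then for every integer $n\ge 1$ and every $j\in\mathbb{Z}$, $$[F^n(x)]_j=\bar{x}_{j-2}\,\bar{x}_{j-1}\,x_j+\left(\prod_{i=j-2}^{j+n-3}\bigl(1-\bar{x}_i\bar{x}_{i+1}\bigr)\right)\bigl(\bar{x}_{j+n-2}\,x_{j+n-1}+x_{j+n-2}\,x_{j+n}\bigr),$$ where $\bar{x}_i=1-x_i$ and the arithmetic is that of the integers.
   Context: Rule 172 is the elementary cellular automaton with local function $f:\{0,1\}^3\to\{0,1\}$ given by $f(x_1,x_2,x_3)=x_2$ if $x_1=0$ and $f(x_1,x_2,x_3)=x_3$ if $x_1=1$. Its global function $F:\{0,1\}^{\mathbb{Z}}\to\{0,1\}^{\mathbb{Z}}$ is defined by $[F(x)]_i=f(x_{i-1},x_i,x_{i+1})$ for all $i\in\mathbb{Z}$, and $F^n$ denotes the $n$-fold composition of $F$ with itself. *)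

(* Defs.v *)
From mathcomp Require Import all_boot all_order all_algebra.

Set Implicit Arguments.
Unset Strict Implicit.
Unset Printing Implicit Defensive.

Import Order.TTheory GRing.Theory Num.Theory.
Local Open Scope ring_scope.

Definition config := int -> bool.

Definition rule172 (x1 x2 x3 : bool) : bool := if x1 then x3 else x2.

Definition global172 (x : config) : config :=
  fun i => rule172 (x (i - 1)) (x i) (x (i + 1)).

Definition cell (x : config) (i : int) : int := (x i : nat)%:Z.

Definition ccell (x : config) (i : int) : int := 1 - cell x i.

(* Main.v *)
(* Induct on n, applying the formula for F^n to y = F x. A block 00 of y at i is
   either a block 00 of x at i or the middle of a block 1100 of x, which has its
   own 00 one place further right. Hence F preserves the first term, and a window
   of y is free of 00 exactly when it is so in x, up to a 1100 overlapping its
   right end; such a 1100 makes the next factor of the product vanish. *)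
Require Import Defs.
From mathcomp Require Import all_boot all_order all_algebra.
From mathcomp Require Import ring.

Set Implicit Arguments.
Unset Strict Implicit.
Unset Printing Implicit Defensive.

Import Order.TTheory GRing.Theory Num.Theory.
Local Open Scope ring_scope.

Lemma cell_global172 (x : config) (i : int) :
  cell (global172 x) i =
    ccell x (i - 1) * cell x i + cell x (i - 1) * cell x (i + 1).
Proof.
by rewrite /ccell /cell /global172; case: (x (i - 1)); case: (x i); case: (x (i + 1)).
Qed.

(** If [x i] is 0, the new cell at [i + 1] copies [x (i + 1)], so a new 00 needs an old one; if
    [x i] is 1, it needs 1100 from [i - 1] on. *)
Lemma zero_pair_global172 (x : config) (i : int) :
  1 - ccell (global172 x) i * ccell (global172 x) (i + 1) =
    (1 - ccell x i * ccell x (i + 1))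
    * (1 - cell x (i - 1) * cell x i * ccell x (i + 1) * ccell x (i + 2)).
Proof.
rewrite {1 2}/ccell !cell_global172 addrK -addrA /ccell /cell.
by case: (x (i - 1)); case: (x i); case: (x (i + 1)); case: (x (i + 2)).
Qed.

Lemma prod_zero_pair_global172 (x : config) (i : int) (n : nat) :
  \prod_(k < n.+1) (1 - ccell (global172 x) (i + k%:Z)
                        * ccell (global172 x) (i + k%:Z + 1)) =
    (\prod_(k < n.+1) (1 - ccell x (i + k%:Z) * ccell x (i + k%:Z + 1)))
    * (1 - cell x (i + n%:Z - 1) * cell x (i + n%:Z)
           * ccell x (i + n%:Z + 1) * ccell x (i + n%:Z + 2)).
Proof.
elim: n => [|n IHn]; first by rewrite !big_ord1 zero_pair_global172.
rewrite big_ord_recr [in RHS]big_ord_recr /= IHn zero_pair_global172.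
set P := \prod_(k < n.+1) _.
have -> : i + n.+1%:Z = i + n%:Z + 1 by rewrite -addn1 PoszD addrA.
(* The 1100 excluded by [IHn] has its 00 at [i + n + 1], where the new factor already vanishes. *)
rewrite addrK -!(addrA (i + n%:Z)) -!mulrA; congr (P * _).
rewrite /ccell /cell.
case: (x (i + n%:Z - 1)); case: (x (i + n%:Z)); case: (x (i + n%:Z + 1));
  by case: (x (i + n%:Z + (1 + 1))); case: (x (i + n%:Z + (1 + 2))).
Qed.

(** A new 00 at [j - 2] arising from 1100 contributes nothing: then [x (j - 1)] and [x j] are 0, so
    the new cell at [j] is 0. *)
Lemma zero_pair_mul_global172 (x : config) (j : int) :
  ccell (global172 x) (j - 2) * ccell (global172 x) (j - 1)
    * cell (global172 x) j =
  ccell x (j - 2) * ccell x (j - 1) * cell x j.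
Proof.
rewrite {1 2}/ccell !cell_global172 -!addrA -!opprD.
rewrite (_ : - 2 + 1 = - 1 :> int) // (_ : - 1 + 1 = 0 :> int) // addr0 /ccell /cell.
case: (x (j - (2 + 1))); case: (x (j - 2)); case: (x (j - 1));
  by case: (x j); case: (x (j + 1)).
Qed.

(* [m] is the position of the last factor of the product. *)
Lemma right_end_global172 (x : config) (m : int) :
  (1 - ccell x m * ccell x (m + 1))
  * (1 - cell x (m - 1) * cell x m * ccell x (m + 1) * ccell x (m + 2))
  * (ccell (global172 x) (m + 1) * cell (global172 x) (m + 2)
     + cell (global172 x) (m + 1) * cell (global172 x) (m + 3)) =
  (1 - ccell x m * ccell x (m + 1))
  * (1 - ccell x (m + 1) * ccell x (m + 2))
  * (ccell x (m + 2) * cell x (m + 3) + cell x (m + 2) * cell x (m + 4)).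
Proof.
rewrite [ccell (global172 x) _]/ccell !cell_global172 -!(addrA m) subrr addr0.
rewrite (_ : 2 - 1 = 1 :> int) // (_ : 3 - 1 = 2 :> int) //.
rewrite (_ : 1 + 1 = 2 :> int) // (_ : 2 + 1 = 3 :> int) // (_ : 3 + 1 = 4 :> int) //.
rewrite /ccell /cell.
(* Given no 00 at [m], a 00 at [m + 1] forces [x m] to be 1 and both sides vanish; otherwise both
   last factors equal [x (m + 3)] or [x (m + 4)], as [x (m + 2)] is 0 or 1. *)
case: (x (m - 1)); case: (x m); case: (x (m + 1)); case: (x (m + 2));
  by case: (x (m + 3)); case: (x (m + 4)).
Qed.

(* The product over j - 2 <= i <= j + n - 3 is indexed by i = j - 2 + k with
   0 <= k < n. *)
Theorem proposition4p1 (x : config) (n : nat) (j : int) :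
  (1 <= n)%N ->
  cell (iter n global172 x) j =
    ccell x (j - 2) * ccell x (j - 1) * cell x j
    + (\prod_(k < n) (1 - ccell x (j - 2 + k%:Z) * ccell x (j - 2 + k%:Z + 1)))
      * (ccell x (j + n%:Z - 2) * cell x (j + n%:Z - 1)
         + cell x (j + n%:Z - 2) * cell x (j + n%:Z)).
Proof.
case: n => // n _; elim: n x => [|n IHn] x.
  rewrite big_ord1 /= cell_global172 addr0 -!addrA addrN addr0.
  rewrite (_ : - 2 + 1 = - 1 :> int) // (_ : 1 - 2 = - 1 :> int) // /ccell /cell.
  by case: (x (j - 2)); case: (x (j - 1)); case: (x j); case: (x (j + 1)).
rewrite iterSr IHn zero_pair_mul_global172 prod_zero_pair_global172; congr (_ + _).
(* Splitting two factors off the right product and one off the left leaves the common [P]; the rest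
   concerns only the right end. *)
rewrite [in RHS]big_ord_recr big_ord_recr /=.
set P := \prod_(k < n) _; set m := j - 2 + n%:Z.
have -> : j + n.+1%:Z - 2 = m + 1 by rewrite /m intS; ring.
have -> : j + n.+1%:Z - 1 = m + 2 by rewrite /m intS; ring.
have -> : j + n.+1%:Z = m + 3 by rewrite /m intS; ring.
have -> : j - 2 + n.+1%:Z = m + 1 by rewrite /m intS; ring.
have -> : j + n.+2%:Z - 2 = m + 2 by rewrite /m !intS; ring.
have -> : j + n.+2%:Z - 1 = m + 3 by rewrite /m !intS; ring.
have -> : j + n.+2%:Z = m + 4 by rewrite /m !intS; ring.
have -> : m + 1 + 1 = m + 2 by ring.
rewrite -!(mulrA P); congr (P * _).
exact: right_end_global172.
Qed.
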